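(* Let $e_1,\dots,e_r$ be (distinct) primitive idempotents of $R=\mathbb{F}_q[H]$ and let $j\in\{1,2,\dots,r\}$ be fixed. Let $e_j=e_{j1}+e_{j2}+\dots+e_{js_j}$ be the decomposition of $e_j$ as a sum of distinct primitive idempotents of $S=\mathbb{F}_{q^l}[H]$. For $i=1,2,\dots,s_j$, let $\pi_i$ be a primitive element of $Se_{ji}$, a finite field of $q^{ld_j}$ elements. Let $L_j=\frac{q^{ld_j}-1}{q^{k_j}-1}$ and $T_j=\{\infty,0,1,2,\dots,q^{ld_j}-2\}$. Then the elements $$\pi_t^{\nu_t}+\pi_{t+1}^{\nu_{t+1}}+\dots+\pi_{s_j}^{\nu_{s_j}},$$ for all $1\le t\le s_j$, $0\le \nu_t\le L_j-1$, and $\nu_{t+1},\nu_{t+2},\dots,\nu_{s_j}\in T_j$, are a complete set of representatives of $[(Se_j)^*]$, where by convention $\pi_i^{\infty}=0$.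
   Context: Let $\mathbb{F}_q$ be a finite field with $q$ elements, $G$ a finite abelian group (written additively), $H\le G$ a subgroup of index $l=[G:H]$, with $\gcd(q,|H|)=1$. Let $R=\mathbb{F}_q[H]$ and $S=\mathbb{F}_{q^l}[H]\supseteq R$ be the group rings. An idempotent is a nonzero element $e$ with $e^2=e$; an idempotent $e$ is primitive if for every other idempotent $f$ either $ef=e$ or $ef=0$. Notation: $k_j=\dim_{\mathbb{F}_q}(Re_j)$ and $d_j=\dim_{\mathbb{F}_{q^l}}(Se_{j1})$; one has $d_j=k_j/\gcd(l,k_j)$ and $s_j=\gcd(l,k_j)$, and all the $Se_{ji}$, $1\le i\le s_j$, have the same $\mathbb{F}_{q^l}$-dimension $d_j$. Each $Se_{ji}$ is a field with identity $e_{ji}$ (so $\pi_i^0=e_{ji}$); a primitive element is a generator of its multiplicative group. $(Se_j)^*$ is the set of nonzero elements of $Se_j$, and $(Re_j)^\times$ is the group of units of the ring $Re_j$ (whose identity is $e_j$). On $(Se_j)^*$ define the equivalence relation $A\sim B$ iff there is $u\in(Re_j)^\times$ with $A=uB$; $[(Se_j)^*]$ denotes the set of equivalence classes. A complete set of representatives contains exactly one element of each class. *)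

(* Defs.v *)
From HB Require Import structures.
From mathcomp Require Import all_boot all_order all_algebra all_fingroup.
From mathcomp Require Import all_solvable all_field.

Set Implicit Arguments.
Unset Strict Implicit.
Unset Printing Implicit Defensive.

Import GRing.Theory.
Local Open Scope ring_scope.

(* The group algebra K[gT]: functions gT -> K with pointwise addition and     *)
(* scaling, and with the convolution product; a stands for the formal sum of  *)
(* the a x . x. The group law of gT is written multiplicatively.              *)
Definition group_algebra (K : Type) (gT : finGroupType) : Type :=
  {ffun gT -> K}.

Section GroupAlgebraStructure.

Variables (K : fieldType) (gT : finGroupType).
Local Notation A := (group_algebra K gT).

HB.instance Definition _ := Vector.copy A {ffun gT -> K^o}.

Implicit Types a b c : A.

Definition galg_one : A := [ffun x : gT => (x == 1%g)%:R].

Definition galg_mul a b : A :=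
  [ffun x : gT => \sum_(y : gT) a y * b (y^-1 * x)%g].

Fact galg_mulA : associative galg_mul.
Proof.
move=> a b c; apply/ffunP=> x; rewrite !ffunE.
under eq_bigr do rewrite ffunE mulr_sumr.
under [RHS]eq_bigr do rewrite ffunE mulr_suml.
rewrite [RHS]exchange_big; apply: eq_bigr => y _ /=.
rewrite (reindex_inj (mulgI y^-1%g)) /=; apply: eq_bigr => z _.
by rewrite mulrA invMg invgK -!mulgA mulKVg.
Qed.

Fact galg_mul1r : left_id galg_one galg_mul.
Proof.
move=> a; apply/ffunP=> x; rewrite ffunE (bigD1 1%g) //= ffunE eqxx mul1r.
rewrite invg1 mul1g big1 ?addr0 // => y /negPf y_neq1.
by rewrite ffunE y_neq1 mul0r.
Qed.

Fact galg_mulr1 : right_id galg_one galg_mul.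
Proof.
move=> a; apply/ffunP=> x; rewrite ffunE (bigD1 x) //= ffunE mulVg eqxx mulr1.
rewrite big1 ?addr0 // => y y_neqx.
by rewrite ffunE -eq_mulVg1 (negPf y_neqx) mulr0.
Qed.

Fact galg_mulDl : left_distributive galg_mul +%R.
Proof.
move=> a b c; apply/ffunP=> x; rewrite !ffunE -big_split.
by apply: eq_bigr => y _; rewrite ffunE mulrDl.
Qed.

Fact galg_mulDr : right_distributive galg_mul +%R.
Proof.
move=> a b c; apply/ffunP=> x; rewrite !ffunE -big_split.
by apply: eq_bigr => y _; rewrite ffunE mulrDr.
Qed.

Fact galg_one_neq0 : galg_one != 0.
Proof.
apply/eqP=> /ffunP/(_ 1%g)/eqP.
by rewrite !ffunE eqxx oner_eq0.
Qed.

HB.instance Definition _ := GRing.Zmodule_isNzRing.Build A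
  galg_mulA galg_mul1r galg_mulr1 galg_mulDl galg_mulDr galg_one_neq0.

Fact galg_scaleAl (k : K) a b : k *: (a * b) = (k *: a) * b.
Proof.
apply/ffunP=> x; rewrite !ffunE scaler_sumr.
by apply: eq_bigr => y _; rewrite ffunE; apply: mulrA.
Qed.

HB.instance Definition _ := GRing.Lmodule_isLalgebra.Build K A galg_scaleAl.

Fact galg_scaleAr (k : K) a b : k *: (a * b) = a * (k *: b).
Proof.
apply/ffunP=> x; rewrite !ffunE scaler_sumr.
by apply: eq_bigr => y _; rewrite ffunE; apply: mulrCA.
Qed.

HB.instance Definition _ := GRing.Lalgebra_isAlgebra.Build K A galg_scaleAr.
HB.instance Definition _ := Algebra_isFalgebra.Build K A.

End GroupAlgebraStructure.

HB.instance Definition _ (K : finFieldType) (gT : finGroupType) :=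
  Finite.copy (group_algebra K gT) {ffun gT -> K}.

(* The inclusion K[gT] -> L[gT] induced by an embedding f : K -> L.           *)
Definition galg_map (K L : Type) (gT : finGroupType) (f : K -> L)
    (a : group_algebra K gT) : group_algebra L gT :=
  [ffun x : gT => f (a x)].

Section Ideals.

Variables (K : finFieldType) (gT : finGroupType).
Local Notation A := (group_algebra K gT).
Implicit Types e f u v x : A.

Definition idempotent_elt e : bool := (e != 0) && (e * e == e).

(* Only meant for commutative A, as are the definitions below.                *)
Definition primitive_idempotent e : Prop :=
  idempotent_elt e /\
  forall f, idempotent_elt f -> f != e -> e * f = e \/ e * f = 0.

(* The ideal A e = {a * e | a in A}, as a K-subspace of A.                    *)
Definition pideal e : {vspace A} := limg (amulr e).

Definition pideal_nonzero e : {set A} := [set x | (x \in pideal e) && (x != 0)].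

(* Units of the ring A e, whose identity is e.                                *)
Definition pideal_unit e u : bool :=
  (u \in pideal e) && [exists v, (v \in pideal e) && (u * v == e)].

(* Powers of an element x of the ring A e, so that the exponent 0 yields e;   *)
(* None stands for the exponent infinity, with x ^ infinity = 0.              *)
Definition pideal_exp e x (n : option nat) : A :=
  if n is Some m then e * x ^+ m else 0.

(* x generates the (finite) group of units of A e.                            *)
Definition primitive_elt e x : Prop :=
  pideal_unit e x /\
  forall u, pideal_unit e u -> exists n : nat, u = pideal_exp e x (Some n).

End Ideals.

(* A ~ B iff A = u * B for some unit u of the ring F[gT] e.                   *)
Definition pideal_equiv (F K : finFieldType) (gT : finGroupType) (iota : F -> K)
    (e : group_algebra F gT) : rel (group_algebra K gT) :=
  fun A B => [exists u, pideal_unit e u && (A == galg_map iota u * B)].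

(* Main.v *)
Require Import Defs.
From HB Require Import structures.
From mathcomp Require Import all_boot all_order all_algebra all_fingroup.
From mathcomp Require Import all_solvable all_field.

Set Implicit Arguments.
Unset Strict Implicit.
Unset Printing Implicit Defensive.

Import GRing.Theory.
Local Open Scope ring_scope.

(** Write S = K[H] and R = F[H].  As q is prime to |H|, both group algebras are
reduced: raising to the power #|K| only permutes the coefficients of an element
of S, along the bijection h |-> h ^ #|K| of H, hence is injective
([galg_frobenius], [galg_reduced]).  In a finite commutative reduced ring every
nonzero x has a power that is a nonzero idempotent, so the ideal cut out by a
primitive idempotent is a field ([primitive_corner_group]).  Thus R e_j is a
field, and S e_j is the product of the fields S f_i.

The fields S f_i all have the same size ([leq_card_corner]): the Frobenius
automorphism of K over F acts on the coefficients of elements of S, the sum of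
an orbit of primitive idempotents lies in R, and primitivity of e_j forces this
sum to be e_j, so that the f_i form a single orbit ([primitive_phi_orbit]).

A unit u of R e_j acts on each S f_i as multiplication by u f_i, and u |-> u f_i
is injective because R e_j is a field.  The orbit of a nonzero A can therefore
be normalized at the first index t with A f_t <> 0: the (q^k - 1)-element group
of the u f_t lies in the cyclic group generated by pi_t, so exactly one pi_t^n
with n < L is in its coset of A f_t ([cyclic_coset_reps]).  The element u that
achieves this is unique, hence the components after t are determined, and they
can be arbitrary ([leading_exists], [leading_unique]). *)

(** * Transversals, and multiplicative groups inside finite rings *)

Lemma is_transversal_equivalence_partition (T : finType) (R : rel T)
    (D X : {set T}) :
  {in D & &, equivalence_rel R} -> X \subset D ->
  {in D, forall d, exists2 x, x \in X & R d x} ->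
  {in X &, forall x y, R x y -> x = y} ->
  is_transversal X (equivalence_partition R D) D.
Proof.
move=> eqvR sXD coverX sepX; apply/and3P; split=> //.
  exact: equivalence_partitionP.
apply/forall_inP=> _ /imsetP[d Dd ->].
have [x Xx Rdx] := coverX d Dd; have Dx := subsetP sXD x Xx.
apply/cards1P; exists x; apply/setP=> y; rewrite !inE.
apply/and3P/eqP=> [[Xy Dy Rdy] | -> //].
have [_ Rtr] := eqvR d x y Dd Dx Dy.
by apply/esym/sepX; rewrite // -Rtr.
Qed.

Section Corners.

Variable A : finComNzRingType.
Implicit Types (e f g x y u v : A) (C U V : {set A}).

(** The ideal e A for an idempotent e, written as a fixed-point set so that
membership is an equation. *)
Definition corner e : {set A} := [set x | x * e == x].

Lemma cornerP e x : reflect (x * e = x) (x \in corner e).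
Proof. by rewrite inE; apply: eqP. Qed.

Definition primitive e : Prop :=
  [/\ e != 0, e * e = e & forall g, g * g = g -> g * e = g -> g = 0 \/ g = e].

Definition reduced : Prop := forall x n, x ^+ n = 0 -> x = 0.

(** The powers of x are eventually periodic, and an exponent that is a multiple
of the period and beyond the preperiod gives an idempotent. *)
Lemma exists_idempotent_exp x :
  exists2 n, (0 < n)%N & x ^+ n * x ^+ n = x ^+ n.
Proof.
have /injectivePn[a [b neq_ab eq_ab]]:
    ~~ injectiveb (fun i : 'I_(#|A|.+1) => x ^+ i).
  by apply/injectiveP=> /leq_card; rewrite card_ord ltnn.
wlog lt_ab: a b neq_ab eq_ab / (a < b)%N.
  move=> IH; have [||/val_inj/eqP] := ltngtP a b; last first.
  - by rewrite (negPf neq_ab).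
  - by apply: IH => //; rewrite eq_sym.
  - exact: IH.
have step m : (a <= m)%N -> x ^+ (m + (b - a)) = x ^+ m.
  move=> le_am; rewrite -{1}(subnK le_am) -addnA subnKC ?(ltnW lt_ab) //.
  by rewrite exprD -eq_ab -exprD subnK.
have period m k : (a <= m)%N -> x ^+ (m + k * (b - a)) = x ^+ m.
  move=> le_am; elim: k => [|k IHk]; first by rewrite mul0n addn0.
  by rewrite mulSnr addnA step // (leq_trans le_am) ?leq_addr.
exists (b * (b - a))%N.
  by rewrite muln_gt0 subn_gt0 lt_ab (leq_trans _ lt_ab).
rewrite -exprD period // (leq_trans (ltnW lt_ab)) // leq_pmulr //.
by rewrite subn_gt0.
Qed.

(** A group under multiplication with neutral element e, which is in general
not a subgroup of the units of A. *)
Definition corner_group e V : Prop :=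
  [/\ V \subset corner e, e \in V, {in V &, forall x y, x * y \in V}
    & {in V, forall x, exists2 y, y \in V & x * y = e}].

(** Some positive power of a nonzero x in e A is idempotent; it is nonzero since
A is reduced, hence it is e by primitivity, which makes x invertible. *)
Lemma primitive_corner_group e :
  reduced -> primitive e -> corner_group e (corner e :\ 0).
Proof.
move=> redA [e_n0 ee prim_e].
have inv x : x \in corner e :\ 0 -> exists2 y, y \in corner e :\ 0 & x * y = e.
  case/setD1P=> x_n0 /cornerP xe.
  have [[//|n] _ idem_xn] := exists_idempotent_exp x.
  have xne: x ^+ n.+1 * e = x ^+ n.+1 by rewrite exprSr -mulrA xe.
  case: (prim_e _ idem_xn xne) => [/redA x0 | def_e].
    by rewrite x0 eqxx in x_n0.
  have xy : x * (x ^+ n * e) = e by rewrite mulrA -exprS def_e.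
  exists (x ^+ n * e) => //; apply/setD1P; split.
    by apply: contra_neq e_n0 => y0; rewrite -xy y0 mulr0.
  by apply/cornerP; rewrite -mulrA ee.
split=> //; first exact: subsetDl.
  by apply/setD1P; split=> //; apply/cornerP.
move=> x y Cx /setD1P[y_n0 /cornerP ye].
have [z _ xz] := inv x Cx; case/setD1P: Cx => _ /cornerP xe.
apply/setD1P; split; last by apply/cornerP; rewrite -mulrA ye.
by apply: contra_neq y_n0 => xy0; rewrite -ye -xz mulrCA mulrA xy0 mul0r.
Qed.

Lemma primitive_mul_eq0 e f : primitive e -> primitive f -> e != f -> e * f = 0.
Proof.
move=> [_ ee prim_e] [_ ff prim_f] /eqP neq_ef.
have idem : e * f * (e * f) = e * f by rewrite mulrACA ee ff.
have [|//|ef_e] := prim_e _ idem; first by rewrite mulrAC ee.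
have [|//|ef_f] := prim_f _ idem; first by rewrite -mulrA ff.
by rewrite -ef_e ef_f in neq_ef.
Qed.

(** If n0 is the least positive exponent with e p^n0 in V, division by n0 writes
every element of C uniquely as v p^n with v in V and n < n0. Counting these
pairs gives #|C| = #|V| * n0, that is n0 = L; for V = {e} this says that p has
order #|C|. *)
Lemma cyclic_coset_reps e C V p (L := (#|C| %/ #|V|)%N) :
    corner_group e C -> corner_group e V -> V \subset C ->
    p \in C -> {in C, forall x, exists n, x = e * p ^+ n} ->
  {in C, forall x, exists2 v, v \in V & exists2 n, (n < L)%N & x = v * p ^+ n}
  /\ {in V, forall v m n, (m < L)%N -> (n < L)%N ->
        e * p ^+ m = v * p ^+ n -> m = n}.
Proof.
move=> [sCe Ce CM CV] [sVe Ve VM VV] sVC Cp gen_p.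
have ee : e * e = e by apply/cornerP/(subsetP sVe).
have pe : p * e = p by apply/cornerP/(subsetP sCe).
have idC x : x \in C -> x * e = x by move=> Cx; apply/cornerP/(subsetP sCe).
have epC n : e * p ^+ n \in C.
  by elim: n => [|n IHn]; rewrite ?mulr1 // exprSr mulrA CM.
have expC x n : x \in C -> x * p ^+ n \in C.
  by move=> Cx; rewrite -(idC x Cx) -mulrA CM ?epC.
have cancel_p n x y : x \in C -> y \in C -> x * p ^+ n = y * p ^+ n -> x = y.
  move=> Cx Cy eq_xy; have [z _ pz] := CV _ (epC n).
  have split_e w : w * (e * p ^+ n * z) = w * p ^+ n * (e * z).
    by rewrite -[e * _ * z]mulrA [e * (_ * _)]mulrCA [LHS]mulrA.
  by rewrite -(idC x Cx) -(idC y Cy) -pz !split_e eq_xy.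
have exP : exists n, (0 < n)%N && (e * p ^+ n \in V).
  have [y Cy py] := CV p Cp; have [n def_y] := gen_p y Cy.
  by exists n.+1; rewrite /= exprS mulrCA -def_y py.
case: (ex_minnP exP) => n0 /andP[n0_gt0 Vn0] min_n0.
have reps x : x \in C ->
  exists2 v, v \in V & exists2 n, (n < n0)%N & x = v * p ^+ n.
- case/gen_p=> n ->; exists (e * (e * p ^+ n0) ^+ (n %/ n0)).
    by elim: (n %/ n0)%N => [|k IHk]; rewrite ?mulr1 // exprSr mulrA VM.
  exists (n %% n0)%N; first by rewrite ltn_mod.
  have idem k : e * e ^+ k = e.
    by elim: k => [|k IHk]; rewrite ?mulr1 // exprS mulrA ee.
  by rewrite exprMn mulrA idem -exprM -mulrA -exprD mulnC -divn_eq.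
(* With m and n in this order, cancellation puts p^(m - n) in V, against the
   minimality of n0 unless m = n. *)
have sep0 v m n : v \in V -> (m < n0)%N -> (n <= m)%N ->
  e * p ^+ m = v * p ^+ n -> m = n.
- move=> Vv lt_m le_nm; rewrite -{1}(subnK le_nm) exprD mulrA.
  move/(cancel_p _ _ _ (epC _) (subsetP sVC v Vv)) => def_v.
  apply/eqP; rewrite eqn_leq le_nm andbT -subn_eq0 -leqn0 leqNgt.
  apply/negP=> lt_nm; have := min_n0 (m - n)%N.
  rewrite lt_nm def_v Vv => /(_ isT) /leq_trans/(_ (leq_subr _ _)).
  by rewrite leqNgt lt_m.
have sep v m n : v \in V -> (m < n0)%N -> (n < n0)%N ->
  e * p ^+ m = v * p ^+ n -> m = n.
- move=> Vv lt_m lt_n eq_mn.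
  have [/sep0 H|/ltnW/sep0 H] := leqP n m; first exact: H eq_mn.
  have [w Vw vw] := VV v Vv; apply/esym; apply: (H w) => //.
  by rewrite -vw mulrAC -eq_mn mulrC mulrA idC // (subsetP sVC).
have def_n0 : n0 = L.
  suff cardC : #|C| = (#|V| * n0)%N.
    by rewrite /L cardC mulKn // (cardD1 e) Ve.
  rewrite -[n0 in RHS]card_ord -[#|'I_n0|]cardsT -cardsX.
  rewrite -(card_in_imset (f := fun vn : A * 'I_n0 => vn.1 * p ^+ vn.2)).
    apply: eq_card => x; apply/idP/imsetP => [/reps[v Vv [n lt_n ->]] | ].
      by exists (v, Ordinal lt_n) => //; rewrite !inE Vv.
    by case=> -[v n] /setXP[/(subsetP sVC) Cv _] ->; apply: expC.
  move=> [v m] [w n] /setXP[/= Vv _] /setXP[/= Vw _] eq_vw.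
  have [Cv Cw] := (subsetP sVC v Vv, subsetP sVC w Vw).
  have [v' Vv' vv'] := VV v Vv.
  have eq_mn : m = n.
    apply/val_inj/(sep (v' * w)); rewrite ?VM ?ltn_ord //.
    by rewrite -mulrA -eq_vw mulrA [v' * v]mulrC vv'.
  by rewrite eq_mn in eq_vw *; rewrite (cancel_p _ _ _ Cv Cw eq_vw).
by rewrite -def_n0; split=> // v Vv m n; apply: sep.
Qed.

End Corners.

(** * Automorphisms permuting primitive idempotents *)

Section Automorphism.

Variables (A : finComNzRingType) (phi : {rmorphism A -> A}).
Hypothesis phi_inj : injective phi.
Implicit Types (e f g : A).

Lemma primitive_iter n f : primitive f -> primitive (iter n phi f).
Proof.
elim: n => //= n IHn /IHn{IHn}; move: (iter n phi f) => {n f}f [f_n0 ff prim_f].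
split=> [||g]; first by rewrite raddf_eq0.
  by rewrite -rmorphM ff.
rewrite -[g](f_finv phi_inj) -!rmorphM => /phi_inj gg /phi_inj gf.
by have [->|->] := prim_f _ gg gf; [left; apply: rmorph0 | right].
Qed.

(** The sum of the orbit of f is a nonzero idempotent below e fixed by phi, so
it is e; since f' e = f', some member of the orbit has a nonzero product with
f', and orthogonality makes it equal to f'. *)
Lemma primitive_phi_orbit e f f' :
    primitive f -> primitive f' -> phi e = e -> f * e = f -> f' * e = f' ->
    (forall g, g * g = g -> g * e = g -> phi g = g -> g = 0 \/ g = e) ->
  exists n, f' = iter n phi f.
Proof.
move=> pf pf' phi_e fe f'e inv_e.
pose O := fingraph.orbit phi f; pose g := \sum_(x <- O) x.
have O_prim x : x \in O -> primitive x.
  by rewrite -fconnect_orbit => /iter_findex <-; apply: primitive_iter.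
have mul_g x : x \in O -> x * g = x.
  move=> Ox; rewrite mulr_sumr (bigD1_seq x) ?orbit_uniq //=.
  rewrite big_seq_cond big1 ?addr0; first by case: (O_prim x Ox).
  move=> y /andP[Oy y_neqx].
  by apply: primitive_mul_eq0; [exact: O_prim.. | rewrite eq_sym].
have Oe x : x \in O -> x * e = x.
  rewrite -fconnect_orbit => /iter_findex <-; elim: (findex _ _ _) => //= n IHn.
  by rewrite -{1}phi_e -rmorphM IHn.
have [|||g0|def_e] := inv_e g.
- by rewrite {1}/g mulr_suml; apply: eq_big_seq => x /mul_g.
- by rewrite /g mulr_suml; apply: eq_big_seq => x /Oe.
- rewrite /g rmorph_sum /= -(big_map phi predT id); apply: perm_big.
  apply: uniq_perm; rewrite ?map_inj_uniq ?orbit_uniq // => x.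
  apply/mapP/idP => [[y Oy ->] | Ox].
    by rewrite -!fconnect_orbit in Oy *; rewrite (connect_trans Oy) ?fconnect1.
  exists (finv phi x); last by rewrite f_finv.
  rewrite -!fconnect_orbit in Ox *.
  by rewrite (connect_trans Ox) ?fconnect_finv.
- case: pf => /eqP[]; rewrite -(mul_g f) ?g0 ?mulr0 //.
  by rewrite -fconnect_orbit connect0.
have [/hasP[x] | /hasPn Of'0] := boolP (has (fun x => f' * x != 0) O).
  rewrite -fconnect_orbit => Ox f'x; exists (findex phi f x).
  rewrite iter_findex //.
  apply/eqP; apply: contra_neqT f'x; apply: primitive_mul_eq0 => //.
  by apply: O_prim; rewrite -fconnect_orbit.
case: pf' => /eqP[]; rewrite -f'e -def_e mulr_sumr big_seq big1 // => x.
by move/Of'0; rewrite negbK => /eqP.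
Qed.

Lemma leq_card_corner_iter n f : (#|corner f| <= #|corner (iter n phi f)|)%N.
Proof.
elim: n => //= n /leq_trans-> //; rewrite -(card_imset _ phi_inj).
apply/subset_leq_card/subsetP=> _ /imsetP[x /cornerP xf ->].
by apply/cornerP; rewrite -rmorphM xf.
Qed.

End Automorphism.

(** * Normal forms for the action of a group of units on a product of fields *)

Section Transversal.

Variables (A : finComNzRingType) (s N L : nat) (f p : 'I_s -> A) (U : {set A}).
Let e := \sum_(i < s) f i.
Hypothesis f_orth : forall i k, f i * f k = if i == k then f i else 0.
Hypothesis field_f : forall i, corner_group (f i) (corner (f i) :\ 0).
Hypothesis card_f : forall i, #|corner (f i) :\ 0| = N.
Hypothesis Cp : forall i, p i \in corner (f i) :\ 0.
Hypothesis gen_p : forall i,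
  {in corner (f i) :\ 0, forall x, exists n, x = f i * p i ^+ n}.
Hypothesis group_U : corner_group e U.
Hypothesis free_U : forall i, {in U &, injective (fun u => u * f i)}.
Hypothesis def_L : (N %/ #|U|)%N = L.

Implicit Types (t : 'I_s) (x y u : A) (n : nat).

(** The intrinsic form of the representatives: the first nonzero component is at
t, where it is the n-th power of p t. *)
Definition leading t n y : Prop :=
  [/\ y * e = y, y * f t = f t * p t ^+ n
    & forall i : 'I_s, (i < t)%N -> y * f i = 0].

Definition xpow i (n : option nat) : A :=
  if n is Some m then f i * p i ^+ m else 0.

Lemma f_idem i : f i * f i = f i.
Proof. by rewrite f_orth eqxx. Qed.

Lemma f_neq0 i : f i != 0.
Proof. by have [_ /setD1P[]] := field_f i. Qed.

Lemma sum_mul_f i (P : pred 'I_s) (a : 'I_s -> A) :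
  (forall k, P k -> a k * f k = a k) ->
  (\sum_(k < s | P k) a k) * f i = if P i then a i else 0.
Proof.
move=> af; rewrite mulr_suml; under eq_bigr do rewrite -af // -mulrA f_orth.
case: ifP => [Pi|Pi'].
  rewrite (bigD1 i) //= eqxx af // big1 ?addr0 // => k /andP[_ /negPf->].
  by rewrite mulr0.
rewrite big1 // => k Pk; case: eqP => [def_k|_]; last exact: mulr0.
by rewrite -def_k Pk in Pi'.
Qed.

Lemma mul_f_e i : f i * e = f i.
Proof. by rewrite mulrC sum_mul_f // => k _; apply: f_idem. Qed.

Lemma xpow_f i (n : option nat) : xpow i n * f i = xpow i n.
Proof. by case: n => [n|]; rewrite /= ?mul0r // mulrAC f_idem. Qed.

Lemma xpow_surj i x :
  x * f i = x -> exists n : option 'I_N, x = xpow i (omap val n).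
Proof.
have [-> _ | x_n0 xf] := eqVneq x 0; first by exists None.
have Cx : x \in corner (f i) :\ 0 by apply/setD1P; split=> //; apply/cornerP.
have group1 : corner_group (f i) [set f i].
  split=> [||x1 x2|x1]; rewrite ?sub1set ?inE ?f_idem //.
    by move=> /eqP-> /eqP->; rewrite f_idem.
  by move=> /eqP->; exists (f i); rewrite ?inE ?f_idem.
have [|reps _] := cyclic_coset_reps (field_f i) group1 _ (Cp i) (@gen_p i).
  by rewrite sub1set; case: (field_f i).
have [v /set1P->] := reps x Cx; rewrite cards1 divn1 card_f => -[n lt_n ->].
by exists (Some (Ordinal lt_n)).
Qed.

Lemma leadingP t n x :
  (exists nu : {ffun 'I_s -> option 'I_N},
     x = xpow t (Some n) + \sum_(i < s | (t < i)%N) xpow i (omap val (nu i)))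
  <-> leading t n x.
Proof.
split=> [[nu ->] | [xe xt xlt]].
  have pf (k : 'I_s) : (t < k)%N ->
      xpow k (omap val (nu k)) * f k = xpow k (omap val (nu k)).
    by rewrite xpow_f.
  split=> [||i lt_it].
  - rewrite mulrDl -(xpow_f t) -mulrA mul_f_e mulr_suml; congr (_ + _).
    by apply: eq_bigr => i _; rewrite -(xpow_f i) -mulrA mul_f_e.
  - by rewrite mulrDl sum_mul_f // ltnn addr0 xpow_f.
  rewrite mulrDl sum_mul_f // ltnNge ltnW //= addr0 mulrAC f_orth.
  by rewrite -val_eqE gtn_eqF //= mul0r.
have /fin_all_exists[nu def_nu] i :
    exists n : option 'I_N, x * f i = xpow i (omap val n).
  by apply: xpow_surj; rewrite -mulrA f_idem.
exists (finfun nu); rewrite -[LHS]xe mulr_sumr.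
rewrite (bigID (fun i : 'I_s => (t < i)%N)) /=.
rewrite addrC; congr (_ + _); last by apply: eq_bigr => i _; rewrite ffunE.
rewrite (bigD1 t) ?ltnn //= big1 ?addr0 //= => i.
rewrite -leqNgt => /andP[le_it neq_it].
by apply: xlt; rewrite ltn_neqAle le_it andbT.
Qed.

(** The image of U in the multiplicative group of the field f_i A. *)
Let V i := [set u * f i | u in U].

Lemma group_V i : corner_group (f i) (V i).
Proof.
have [sU Ue UM UV] := group_U; split.
- by apply/subsetP=> _ /imsetP[u _ ->]; apply/cornerP; rewrite -mulrA f_idem.
- by apply/imsetP; exists e; rewrite // mulrC mul_f_e.
- move=> _ _ /imsetP[u Uu ->] /imsetP[v Uv ->]; apply/imsetP.
  by exists (u * v); [exact: UM | rewrite mulrACA f_idem].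
move=> _ /imsetP[u Uu ->]; have [v Uv uv] := UV u Uu.
by exists (v * f i); [apply: imset_f | rewrite mulrACA uv f_idem mulrC mul_f_e].
Qed.

Lemma sub_V i : V i \subset corner (f i) :\ 0.
Proof.
apply/subsetP=> x Vx; have [/subsetP sV _ _ VV] := group_V i.
apply/setD1P; split; last exact: sV; have [y _ xy] := VV x Vx.
by apply: contra_neq (f_neq0 i) => x0; rewrite -xy x0 mul0r.
Qed.

(** Freeness of the action makes V i a copy of U, so the same L serves for every
i. *)
Lemma unit_coset_reps i :
  {in corner (f i) :\ 0, forall x,
     exists2 u, u \in U & exists2 n, (n < L)%N & x = u * f i * p i ^+ n}
  /\ {in U, forall u m n, (m < L)%N -> (n < L)%N ->
        f i * p i ^+ m = u * f i * p i ^+ n -> m = n}.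
Proof.
have cardV : #|V i| = #|U| by apply: card_in_imset; apply: free_U.
have [reps sep] :=
  cyclic_coset_reps (field_f i) (group_V i) (sub_V i) (Cp i) (@gen_p i).
rewrite cardV card_f def_L in reps sep; split=> [x | u Uu].
  by case/reps=> _ /imsetP[u Uu ->] xP; exists u.
by apply: sep; apply: imset_f.
Qed.

(** The multiplier u is the inverse of a coset coefficient of x at its first
nonzero component. *)
Lemma leading_exists x : x != 0 -> x * e = x ->
  exists2 u, u \in U & exists t, exists2 n, (n < L)%N & leading t n (u * x).
Proof.
move=> x_n0 xe; have [_ _ _ UV] := group_U.
have /existsP[t0 xt0] : [exists t, x * f t != 0].
  apply: contraR x_n0 => /existsPn xf0; rewrite -xe mulr_sumr big1 // => i _.
  by apply/eqP; rewrite -[_ == _]negbK xf0.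
case: (@arg_minnP _ t0 (fun t => x * f t != 0) val xt0) => t xt min_t.
have [|v Uv [n lt_n def_xt]] := (unit_coset_reps t).1 (x * f t).
  by apply/setD1P; split=> //; apply/cornerP; rewrite -mulrA f_idem.
have [u Uu vu] := UV v Uv; exists u => //; exists t; exists n => //; split.
- by rewrite -mulrA xe.
- by rewrite -mulrA def_xt !mulrA [u * v]mulrC vu [e * _]mulrC mul_f_e.
move=> i lt_it; rewrite -mulrA.
have [-> | /min_t] := eqVneq (x * f i) 0; first exact: mulr0.
by rewrite leqNgt lt_it.
Qed.

Lemma xpow_in_corner i n : xpow i (Some n) \in corner (f i) :\ 0.
Proof.
have [_ Cf CM _] := field_f i.
by elim: n => [|n IHn]; rewrite /= ?mulr1 // exprSr mulrA CM.
Qed.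

(** Multiplication by u preserves the position of the first nonzero component;
comparing these components gives equal exponents, so u acts trivially there and
is e because U acts freely. *)
Lemma leading_unique t n t' n' u x y : u \in U -> (n < L)%N -> (n' < L)%N ->
  leading t n x -> leading t' n' y -> x = u * y -> x = y.
Proof.
move=> Uu lt_n lt_n' lead_x lead_y def_x.
have [_ Ue _ UV] := group_U.
have [xe def_xt xlt] := lead_x; have [ye def_yt' ylt] := lead_y.
have xt : x * f t != 0 by rewrite def_xt; case/setD1P: (xpow_in_corner t n).
have yt' : y * f t' != 0.
  by rewrite def_yt'; case/setD1P: (xpow_in_corner t' n').
have eq_t : t = t'.
  have [lt_t | lt_t | /val_inj //] := ltngtP t t'.
    by case/eqP: xt; rewrite def_x -mulrA ylt ?mulr0.
  have [v Uv uv] := UV u Uu; case/eqP: yt'.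
  rewrite -ye -uv [y * _]mulrC [_ * v]mulrC -[v * u * y]mulrA -def_x -mulrA.
  by rewrite xlt ?mulr0.
rewrite -eq_t in lead_y def_yt' yt' => {ylt t' eq_t}.
have eq_uy : f t * p t ^+ n = u * f t * p t ^+ n'.
  by rewrite -def_xt def_x -mulrA def_yt' mulrA.
have eq_n := (unit_coset_reps t).2 u Uu n n' lt_n lt_n' eq_uy; subst n'.
have [_ _ _ inv_f] := field_f t; have [z _ ptz] := inv_f _ (xpow_in_corner t n).
suff def_u : u = e by rewrite def_x def_u mulrC.
apply: (free_U (i := t)); rewrite // [e * _]mulrC mul_f_e -[RHS]ptz /= eq_uy.
by rewrite -[in LHS]ptz /= !mulrA.
Qed.

End Transversal.

(** * Group algebras of finite abelian groups *)

Section GroupAlgebraMap.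

Variables (K L : fieldType) (gT : finGroupType) (iota : {rmorphism K -> L}).
Local Notation map := (@galg_map K L gT iota).

Fact galg_map_is_zmod_morphism : zmod_morphism map.
Proof. by move=> a b; apply/ffunP=> x; rewrite !ffunE rmorphB. Qed.

Fact galg_map_is_monoid_morphism : monoid_morphism map.
Proof.
split=> [|a b]; apply/ffunP=> x; rewrite !ffunE ?rmorph_nat // rmorph_sum.
by apply: eq_bigr => y _; rewrite !ffunE rmorphM.
Qed.

HB.instance Definition _ := GRing.isZmodMorphism.Build
  (group_algebra K gT) (group_algebra L gT) map galg_map_is_zmod_morphism.
HB.instance Definition _ := GRing.isMonoidMorphism.Build
  (group_algebra K gT) (group_algebra L gT) map galg_map_is_monoid_morphism.

Lemma galg_map_inj : injective map.
Proof.
move=> a b /ffunP eq_ab; apply/ffunP=> x; apply: (fmorph_inj iota).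
by have := eq_ab x; rewrite !ffunE.
Qed.

End GroupAlgebraMap.

Lemma pchar_nat_card (F : finFieldType) : [pchar F].-nat #|F|.
Proof.
have [p _ pcharFp] := finPcharP F.
rewrite (eq_pnat _ (pcharf_eq pcharFp)) -cardsT.
exact: abelem_pgroup (fin_ring_pchar_abelem pcharFp).
Qed.

Section AbelianGroupAlgebra.

Variables (K : finFieldType) (gT : finGroupType).
Hypothesis cgT : forall x y : gT, (x * y = y * x)%g.
Local Notation A := (group_algebra K gT).

Fact galg_mulC : commutative (@GRing.mul A).
Proof.
move=> a b; apply/ffunP=> x; rewrite !ffunE.
rewrite (reindex_inj (inj_comp (mulIg x) invg_inj)) /=.
by apply: eq_bigr => y _; rewrite mulrC invMg invgK -mulgA [(y * x)%g]cgT mulKg.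
Qed.

(** The carrier and operations of the group algebra, repackaged with
commutativity; its elements are convertible to those of the group algebra. *)
Definition galg_com : finComNzRingType :=
  HB.pack A (GRing.PzRing_hasCommutativeMul.Build A galg_mulC).

Definition galg_delta (h : gT) : A := [ffun x => (x == h)%:R].

Lemma galg_delta_sum (a : A) : a = \sum_h a h *: galg_delta h.
Proof.
apply/ffunP=> x; rewrite sum_ffunE (bigD1 x) //= !ffunE eqxx [_ *: _]mulr1.
rewrite big1 ?addr0 // => y y_neqx.
by rewrite !ffunE eq_sym (negPf y_neqx) [_ *: _]mulr0.
Qed.

Lemma galg_deltaM h k : galg_delta h * galg_delta k = galg_delta (h * k)%g.
Proof.
apply/ffunP=> x; rewrite !ffunE (bigD1 h) //= !ffunE eqxx mul1r.
rewrite big1 ?addr0 => [|y /negPf y_neqh]; last by rewrite ffunE y_neqh mul0r.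
by congr (_ : bool)%:R; rewrite -(inj_eq (mulgI h)) mulKVg.
Qed.

Lemma galg_deltaX h n : galg_delta h ^+ n = galg_delta (h ^+ n)%g.
Proof. by elim: n => // n IHn; rewrite exprS IHn galg_deltaM -expgS. Qed.

(** With q = #|K|, additivity of the q-th power and a^q = a in K give
(sum of a_k k)^q = sum of a_k k^q; as q is prime to the order of the group, the
k^q are distinct. *)
Lemma galg_frobenius (a : A) (h : gT) : coprime #|K| #|gT| ->
  (a ^+ #|K|) (h ^+ #|K|)%g = a h.
Proof.
move=> coKG.
have char_q : [pchar A].-nat #|K|.
  by rewrite (eq_pnat _ (pchar_lalg A)) pchar_nat_card.
have K_gt0 : (0 < #|K|)%N by apply/card_gt0P; exists 0.
have -> : a ^+ #|K| = \sum_k a k *: galg_delta (k ^+ #|K|)%g.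
  rewrite {1}[a]galg_delta_sum.
  rewrite (big_morph (fun b : A => b ^+ #|K|) (id1 := 0) (op1 := +%R)).
  - by apply: eq_bigr => k _; rewrite exprZn expf_card galg_deltaX.
  - by move=> b c; apply: (@exprDn_pchar galg_com).
  - by rewrite expr0n gtn_eqF.
rewrite sum_ffunE (bigD1 h) //= !ffunE eqxx [_ *: _]mulr1.
rewrite big1 ?addr0 // => k k_neqh.
rewrite !ffunE (inj_eq (_ : injective (fun x : gT => x ^+ #|K|)%g)).
  by rewrite eq_sym (negPf k_neqh) [_ *: _]mulr0.
move=> x y; rewrite coprime_sym -cardsT in coKG.
by apply: (can_in_inj (expgK (G := [set: gT]) coKG)); rewrite inE.
Qed.

Lemma galg_reduced : coprime #|K| #|gT| -> reduced galg_com.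
Proof.
move=> coKG a n an0.
have frob0 (b : A) : b ^+ #|K| = 0 -> b = 0.
  by move=> b0; apply/ffunP=> h; rewrite -(galg_frobenius b h coKG) b0 !ffunE.
suff: (a : A) ^+ (#|K| ^ n) = 0.
  by elim: n {an0} => [//|n IHn]; rewrite expnSr exprM => /frob0/IHn.
rewrite -(subnK (ltnW (ltn_expl n (finNzRing_gt1 K)))) exprD.
by rewrite [_ ^+ n]an0 mulr0.
Qed.

Lemma galg_primitive (e : A) :
  primitive_idempotent e -> @primitive galg_com e.
Proof.
case=> /andP[e_n0 /eqP ee] prim_e; split=> // g gg ge.
have [|g_n0] := eqVneq g 0; first by left.
have [|g_neq] := eqVneq g e; first by right.
have [||eg|eg] := prim_e g; rewrite ?/idempotent_elt ?g_n0 ?gg //=.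
  by right; rewrite -ge -[RHS]eg; apply: galg_mulC.
by left; rewrite -ge -[RHS]eg; apply: galg_mulC.
Qed.

Lemma mem_pideal (e x : A) :
  e * e = e -> (x \in pideal e) = (x \in @corner galg_com e).
Proof.
move=> ee; apply/memv_imgP/cornerP => [[y _ ->] | xe].
  by rewrite lfunE /= -[LHS]mulrA ee.
by exists x; rewrite ?memvf // lfunE.
Qed.

Lemma card_corner (e : A) : e * e = e ->
  #|@corner galg_com e| = (#|K| ^ \dim (pideal e))%N.
Proof.
by move=> ee; rewrite -card_vspace; apply: eq_card => x; rewrite mem_pideal.
Qed.

Lemma pideal_unitE (e u : A) : coprime #|K| #|gT| -> primitive_idempotent e ->
  pideal_unit e u = (u \in @corner galg_com e :\ 0).
Proof.
move=> /galg_reduced redA pe.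
have [sC _ _ inv_e] := primitive_corner_group redA (galg_primitive pe).
have [/andP[e_n0 /eqP ee] _] := pe.
apply/andP/idP => [[Cu /existsP[v /andP[_ /eqP uv]]] | Cu].
  rewrite in_setD1 -mem_pideal // Cu andbT.
  by apply: contra_neq e_n0 => u0; rewrite -uv u0 mul0r.
split; first by rewrite mem_pideal // (subsetP sC).
have [v Cv uv] := inv_e u Cu.
by apply/existsP; exists v; rewrite mem_pideal // (subsetP sC) //; apply/eqP.
Qed.

End AbelianGroupAlgebra.

Section ConstantExtension.

Variables (F K : finFieldType) (iota : {rmorphism F -> K}) (gT : finGroupType).
Hypothesis cgT : forall x y : gT, (x * y = y * x)%g.
Local Notation R := (group_algebra F gT).
Local Notation S := (group_algebra K gT).
Local Notation map := (@galg_map F K gT iota).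

(** In F[X], X^#|F| - X is the product of the X - a over all a in F, so its
image has all its roots in the image of F. *)
Lemma fixed_card_power (x : K) : x ^+ #|F| = x -> exists a, x = iota a.
Proof.
move=> xq; have : (map_poly iota ('X^#|F| - 'X)).[x] == 0.
  by rewrite rmorphB /= map_polyXn map_polyX !hornerE xq subrr.
rewrite finField_genPoly rmorph_prod horner_prod => /prodf_eq0[a _].
rewrite rmorphB /= map_polyX map_polyC !hornerE subr_eq0 => /eqP->.
by exists a.
Qed.

(** Applied with f and f' exchanged as well, this shows that all the S f_i have
the same size. The idempotents of S fixed by the coefficientwise Frobenius map
come from R, which is how primitivity of e enters. *)
Lemma leq_card_corner (e : R) (f f' : galg_com K cgT) :
    primitive_idempotent e -> primitive f -> primitive f' ->
    f * map e = f -> f' * map e = f' ->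
  (#|corner f| <= #|corner f'|)%N.
Proof.
move=> pe pf pf' fe f'e; pose frob (x : K) := x ^+ #|F|.
have char_q : [pchar K].-nat #|F|.
  by rewrite (eq_pnat _ (fmorph_pchar iota)) pchar_nat_card.
have frobB : zmod_morphism frob.
  by move=> x y; rewrite /frob exprDn_pchar // exprNn_pchar.
have frobM : monoid_morphism frob.
  by split=> [|x y]; rewrite /frob ?expr1n ?exprMn.
pose frob_rm : {rmorphism K -> K} := HB.pack frob
  (GRing.isZmodMorphism.Build K K frob frobB)
  (GRing.isMonoidMorphism.Build K K frob frobM).
pose phi : {rmorphism galg_com K cgT -> galg_com K cgT} :=
  (@galg_map K K gT frob_rm : {rmorphism S -> S}).
have phi_inj : injective phi by apply: galg_map_inj.
have [||n ->] := primitive_phi_orbit phi_inj pf pf' _ fe f'e.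
- by apply/ffunP=> x; rewrite !ffunE /= /frob -rmorphXn expf_card.
- move=> g gg ge phi_g.
  have fix_g x : exists a, g x = iota a.
    apply: fixed_card_power.
    by rewrite -[RHS](congr1 (fun h : S => h x) phi_g) ffunE.
  have [g0 def_g0] := fin_all_exists fix_g.
  have def_g : g = map (finfun g0 : R) by apply/ffunP=> x; rewrite !ffunE.
  have [_ _ prim_e] := galg_primitive cgT pe.
  case: (prim_e (finfun g0 : R)) => [||g00|g0e].
  + apply: (@galg_map_inj _ _ gT iota); rewrite rmorphM /= -def_g; exact: gg.
  + apply: (@galg_map_inj _ _ gT iota); rewrite rmorphM /= -def_g; exact: ge.
  + by left; rewrite def_g g00 [map _]rmorph0.
  by right; rewrite def_g g0e.
exact: leq_card_corner_iter.
Qed.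

End ConstantExtension.

(** * The transversal *)

Theorem theorem3p12
  (F K : finFieldType) (iota : {rmorphism F -> K})
  (gT : finGroupType) (G H : {group gT}) (q l : nat)
  (abelG : abelian G) (sHG : H \subset G)
  (def_q : #|F| = q) (def_l : #|G : H|%g = l)
  (cardK : #|K| = (q ^ l)%N) (co_q_H : coprime q #|H|)
  (r : nat) (e : 'I_r -> group_algebra F (subg_of H))
  (inj_e : injective e) (prim_e : forall j, primitive_idempotent (e j))
  (j : 'I_r)
  (s : nat) (s_gt0 : (0 < s)%N) (f : 'I_s -> group_algebra K (subg_of H))
  (inj_f : injective f) (prim_f : forall i, primitive_idempotent (f i))
  (sum_f : galg_map iota (e j) = \sum_(i < s) f i)
  (pi : 'I_s -> group_algebra K (subg_of H))
  (prim_pi : forall i, primitive_elt (f i) (pi i)) :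
  let k := \dim (pideal (e j)) in
  let d := \dim (pideal (f (Ordinal s_gt0))) in
  let L := ((q ^ (l * d) - 1) %/ (q ^ k - 1))%N in
  let T := option 'I_(q ^ (l * d) - 1) in
  let pow (i : 'I_s) (n : option nat) := pideal_exp (f i) (pi i) n in
  let Se_nonzero := pideal_nonzero (galg_map iota (e j)) in
  is_transversal
    [set x | [exists t : 'I_s, exists n : 'I_L, exists nu : {ffun 'I_s -> T},
       x == pow t (Some (n : nat))
            + \sum_(i < s | (t < i)%N) pow i (omap val (nu i))]]
    (equivalence_partition (pideal_equiv iota (e j)) Se_nonzero)
    Se_nonzero.
Proof.
pose k := \dim (pideal (e j)).
pose d := \dim (pideal (f (Ordinal s_gt0))).
pose L := ((q ^ (l * d) - 1) %/ (q ^ k - 1))%N.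
pose T := option 'I_(q ^ (l * d) - 1).
pose pow0 (i : 'I_s) (n : option nat) := pideal_exp (f i) (pi i) n.
pose Se := pideal_nonzero (galg_map iota (e j)).
pose X :=
  [set x | [exists t : 'I_s, exists n : 'I_L, exists nu : {ffun 'I_s -> T},
     x == pow0 t (Some (n : nat))
          + \sum_(i < s | (t < i)%N) pow0 i (omap val (nu i))]].
pose eqv := pideal_equiv (K := K) iota (e j).
change (is_transversal X (equivalence_partition eqv Se) Se).
have cH (x y : subg_of H) : (x * y = y * x)%g.
  apply: val_inj; apply: (centsP abelG); exact: (subsetP sHG) (subgP _).
have cardH : #|subg_of H| = #|H|.
  by rewrite -cardsT; apply/esym; have /card_isog := isog_subg H.
have coF : coprime #|F| #|subg_of H| by rewrite cardH def_q.
have coK : coprime #|K| #|subg_of H| by rewrite cardK -def_q coprimeXl.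
pose R := galg_com F cH; pose S := galg_com K cH.
pose fS : 'I_s -> S := f; pose piS : 'I_s -> S := pi.
pose inc : {rmorphism R -> S} := (@galg_map F K (subg_of H) iota :
  {rmorphism group_algebra F (subg_of H) -> group_algebra K (subg_of H)}).
have inc_inj : injective inc by apply: galg_map_inj.
have pf i : primitive (fS i) by apply: galg_primitive.
have ff i : fS i * fS i = fS i by case: (pf i).
have f_orth i i' : fS i * fS i' = if i == i' then fS i else 0.
  case: eqP => [-> // | /eqP neq_i]; apply: primitive_mul_eq0 => //.
  by rewrite (inj_eq inj_f).
have field_f i : corner_group (fS i) (corner (fS i) :\ 0).
  exact/primitive_corner_group/pf/galg_reduced.
pose eR : R := e j; pose eS := \sum_(i < s) fS i.
have inc_e : inc eR = eS := sum_f.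
have pe : primitive eR := galg_primitive cH (prim_e j).
have field_e := primitive_corner_group (galg_reduced (cgT := cH) coF) pe.
have fe i : fS i * eS = fS i.
  rewrite mulr_sumr (bigD1 i) //= ff big1 ?addr0 // => i'.
  by rewrite eq_sym f_orth => /negPf->.
have card_f i : #|corner (fS i) :\ 0| = (q ^ (l * d) - 1)%N.
  have -> : #|corner (fS i) :\ 0| = #|corner (fS i)|.-1.
    by rewrite (cardsD1 0 (corner _)) inE mul0r eqxx.
  have -> : #|corner (fS i)| = #|corner (fS (Ordinal s_gt0))|.
    have leq_f i1 i2 : (#|corner (fS i1)| <= #|corner (fS i2)|)%N.
      have feR i' : fS i' * galg_map iota (e j) = fS i'.
        by rewrite sum_f; apply: fe.
      exact: leq_card_corner (prim_e j) (pf i1) (pf i2) (feR i1) (feR i2).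
    by apply/eqP; rewrite eqn_leq !leq_f.
  by rewrite card_corner ?ff // cardK -expnM subn1.
have card_e : #|corner eR :\ 0| = (q ^ k - 1)%N.
  have -> : #|corner eR :\ 0| = #|corner eR|.-1.
    by rewrite (cardsD1 0 (corner _)) inE mul0r eqxx.
  by rewrite card_corner ?def_q ?subn1 //; case: pe.
pose U := [set inc u | u in corner eR :\ 0].
have group_U : corner_group eS U.
  have [/subsetP sC Ce CM CV] := field_e; rewrite -inc_e; split.
  - apply/subsetP=> _ /imsetP[u /sC /cornerP ue ->]; apply/cornerP.
    by rewrite -rmorphM ue.
  - exact: imset_f.
  - move=> _ _ /imsetP[u Cu ->] /imsetP[v Cv ->].
    by rewrite -rmorphM imset_f ?CM.
  move=> _ /imsetP[u Cu ->]; have [v Cv uv] := CV u Cu.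
  by exists (inc v); rewrite ?imset_f // -rmorphM uv.
have free_U i : {in U &, injective (fun u => u * fS i)}.
  move=> _ _ /imsetP[u Cu ->] /imsetP[v Cv ->] /= eq_uv.
  have [/subsetP sC _ _ CV] := field_e.
  have /cornerP ue := sC u Cu; have /cornerP ve := sC v Cv.
  apply/eqP/idPn; rewrite (inj_eq inc_inj) => neq_uv.
  (* In the field R e_j, a nonzero u - v would be invertible, but its image in
     S f_i vanishes. *)
  have /CV[w _ uvw] : u - v \in corner eR :\ 0.
    apply/setD1P; split; first by rewrite subr_eq0.
    by apply/cornerP; rewrite mulrBl ue ve.
  have [/eqP[]] := pf i; rewrite -(fe i) -inc_e -uvw rmorphM rmorphB.
  by rewrite mulrA [fS i * _]mulrC mulrBl eq_uv subrr mul0r.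
have card_U : #|U| = (q ^ k - 1)%N by rewrite card_imset.
have C_pi i : piS i \in corner (fS i) :\ 0.
  by rewrite -pideal_unitE //; case: (prim_pi i).
have gen_pi i :
    {in corner (fS i) :\ 0, forall x, exists n, x = fS i * piS i ^+ n}.
  by move=> x; rewrite -pideal_unitE //; case: (prim_pi i) => _; apply.
have def_L : ((q ^ (l * d) - 1) %/ #|U|)%N = L by rewrite card_U.
have SeP x : reflect (x != 0 /\ x * eS = x) (x \in Se).
  rewrite inE mem_pideal.
    by rewrite sum_f andbC; apply: (iffP andP) => -[x0 /cornerP].
  by rewrite -[RHS](congr1 inc (_ : eR * eR = eR)) ?rmorphM //; case: pe.
have equivP x y : reflect (exists2 u, u \in U & x = u * y :> S) (eqv x y).
  apply: (iffP existsP) => [[u /andP[]] | [_ /imsetP[u Cu ->] ->]].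
    by rewrite pideal_unitE // => Cu /eqP->; exists (inc u); rewrite ?imset_f.
  by exists u; rewrite pideal_unitE // Cu /=.
have XP x :
    reflect (exists t, exists2 n, (n < L)%N & leading fS piS t n x) (x \in X).
  rewrite inE; apply: (iffP existsP) => [[t] | [t [n lt_n]]].
    case/existsP=> n /existsP[nu /eqP def_x]; exists t, n => //.
    apply/(leadingP f_orth field_f card_f C_pi gen_pi).
    by exists nu.
  move/(leadingP f_orth field_f card_f C_pi gen_pi) => [nu def_x].
  exists t; apply/existsP; exists (Ordinal lt_n); apply/existsP; exists nu.
  exact/eqP.
have [_ Ue UM UV] := group_U.
apply: is_transversal_equivalence_partition.
- move=> x y z _ /SeP[_ ye] /SeP[_ ze]; split.
    by apply/equivP; exists eS; rewrite // mulrC.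
  case/equivP=> u Uu def_x; have [v Uv uv] := UV u Uu.
  apply/equivP/equivP => -[w Uw def_w].
    exists (v * w); first exact: UM.
    by rewrite -mulrA -def_w def_x mulrA [v * u]mulrC uv mulrC.
  by exists (u * w); [exact: UM | rewrite def_x def_w mulrA].
- apply/subsetP=> x /XP[t [n lt_n lead_x]]; apply/SeP.
  have [xe xt _] := lead_x; split=> //.
  have /setD1P[] := xpow_in_corner field_f C_pi t n.
  by rewrite /= -xt => xt_n0 _; apply: contra_neq xt_n0 => ->; apply: mul0r.
- move=> x /SeP[x_n0 xe].
  have [u Uu [t [n lt_n lead_ux]]] :=
    leading_exists f_orth field_f card_f C_pi gen_pi group_U free_U def_L
      x_n0 xe.
  exists (u * (x : S)); first by apply/XP; exists t, n.
  have [v Uv uv] := UV u Uu; apply/equivP; exists v => //.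
  by rewrite mulrA [v * u]mulrC uv mulrC.
move=> x y /XP[t [n lt_n lead_x]] /XP[t' [n' lt_n' lead_y]] /equivP[u Uu def_x].
exact: (leading_unique f_orth field_f card_f C_pi gen_pi group_U free_U def_L
  Uu lt_n lt_n' lead_x lead_y def_x).
Qed.
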